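(* Let $X$ be a Hilbert $\mathcal{A}$-module over a C*-algebra $\mathcal{A}$ and let $T \in \mathcal{L}(X)$ have closed range. Then the following conditions are equivalent: (i) $T$ is EP with closed range; (ii) there exists an isomorphism $V \in \mathcal{L}(X)$ such that $T^* = VT$; (iii) there exists an isomorphism $V \in \mathcal{L}(X)$ such that $T^{\dag} = VT = TV$.
   Context: $\mathcal{A}$ is an arbitrary (not necessarily unital) C*-algebra. A Hilbert $\mathcal{A}$-module $X$ is a right $\mathcal{A}$-module with an $\mathcal{A}$-valued inner product $\langle\cdot,\cdot\rangle$ (linear in the second variable, conjugate-linear in the first, $\langle x,ya\rangle=\langle x,y\rangle a$, $\langle x,y\rangle=\langle y,x\rangle^*$, $\langle x,x\rangle\ge 0$ with equality iff $x=0$), complete in the norm $\|x\|=\|\langle x,x\rangle\|^{1/2}$. $\mathcal{L}(X)$ is the C*-algebra of bounded adjointable $\mathcal{A}$-linear maps $X\to X$. An isomorphism $V\in\mathcal{L}(X)$ means a bijective (invertible) element of $\mathcal{L}(X)$, not necessarily isometric. $Ran(\cdot)$ denotes the range. An operator $T\in\mathcal{L}(X)$ is called EP if $Ran(T)$ and $Ran(T^* )$ have the same closure. The Moore-Penrose inverse of $T$ is the unique operator $T^{\dag}\in\mathcal{L}(X)$ with $TT^{\dag}T=T$, $T^{\dag}TT^{\dag}=T^{\dag}$, $(TT^{\dag})^*=TT^{\dag}$, $(T^{\dag}T)^*=T^{\dag}T$; it exists in $\mathcal{L}(X)$ if and only if $T$ has closed range. *)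

(* Defs.v *)
From HB Require Import structures.
From mathcomp Require Import all_boot all_order all_algebra.
From mathcomp Require Import all_classical all_reals all_analysis.
From mathcomp Require Import complex.

Set Implicit Arguments.
Unset Strict Implicit.
Unset Printing Implicit Defensive.

Import Order.TTheory GRing.Theory Num.Theory.
Import numFieldNormedType.Exports.

Local Open Scope classical_set_scope.
Local Open Scope complex_scope.
Local Open Scope ring_scope.

(* The algebra need not be unital, so its product is not the one of the
   ring hierarchy of MathComp, whose structures all have a unit.  The norms of
   normed modules over R[i] take their values in R[i]. *)
HB.mixin Record isCStarAlgebra (R : realType) A
    of CompleteNormedModule R[i] A := {
  cmul : A -> A -> A;
  star : A -> A;
  cmulA : forall a b c, cmul a (cmul b c) = cmul (cmul a b) c;
  cmulDl : forall a b c, cmul (a + b) c = cmul a c + cmul b c;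
  cmulDr : forall a b c, cmul a (b + c) = cmul a b + cmul a c;
  cmulZl : forall (z : R[i]) a b, cmul (z *: a) b = z *: cmul a b;
  cmulZr : forall (z : R[i]) a b, cmul a (z *: b) = z *: cmul a b;
  starK : forall a, star (star a) = a;
  starD : forall a b, star (a + b) = star a + star b;
  starZ : forall (z : R[i]) a, star (z *: a) = conjc z *: star a;
  starM : forall a b, star (cmul a b) = cmul (star b) (star a);
  cmul_norm_le : forall a b, `|cmul a b| <= `|a| * `|b|;
  cstar_norm : forall a, `|cmul (star a) a| = `|a| ^+ 2
}.

#[short(type="cstarAlgType")]
HB.structure Definition CStarAlgebra (R : realType) :=
  {A of isCStarAlgebra R A & CompleteNormedModule R[i] A}.

(* A self-adjoint element has nonnegative spectrum iff it is of this form, which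
   makes sense without passing to the unitization. *)
Definition cpositive (R : realType) (A : cstarAlgType R) (a : A) : Prop :=
  exists b : A, a = cmul (star b) b.

(* Conjugate-linearity in the first variable follows from [innerC] and
   linearity in the second one. *)
HB.mixin Record isHilbertModule (R : realType) (A : cstarAlgType R) X
    of CompleteNormedModule R[i] X := {
  ract : X -> A -> X;
  ractDl : forall x y a, ract (x + y) a = ract x a + ract y a;
  ractDr : forall x a b, ract x (a + b) = ract x a + ract x b;
  ractM : forall x a b, ract x (cmul a b) = ract (ract x a) b;
  ractZl : forall (z : R[i]) x a, ract (z *: x) a = z *: ract x a;
  ractZr : forall (z : R[i]) x a, ract x (z *: a) = z *: ract x a;
  inner : X -> X -> A;
  innerDr : forall x y1 y2, inner x (y1 + y2) = inner x y1 + inner x y2;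
  innerZr : forall (z : R[i]) x y, inner x (z *: y) = z *: inner x y;
  inner_ractr : forall x y a, inner x (ract y a) = cmul (inner x y) a;
  innerC : forall x y, inner x y = star (inner y x);
  inner_ge0 : forall x, cpositive (inner x x);
  inner_eq0 : forall x, inner x x = 0 <-> x = 0;
  inner_norm : forall x, `|x| ^+ 2 = `|inner x x|
}.

#[short(type="hilbertModType")]
HB.structure Definition HilbertModule (R : realType) (A : cstarAlgType R) :=
  {X of isHilbertModule R A X & CompleteNormedModule R[i] X}.

Section InnerTheory.
Variables (R : realType) (A : cstarAlgType R) (X : hilbertModType A).
Implicit Types x y : X.

Lemma innerDl x1 x2 y : inner (x1 + x2) y = inner x1 y + inner x2 y.
Proof. by rewrite innerC innerDr starD -!innerC. Qed.

Lemma innerZl (z : R[i]) x y : inner (z *: x) y = conjc z *: inner x y.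
Proof. by rewrite innerC innerZr starZ -innerC. Qed.

Lemma inner0r x : inner x 0 = 0.
Proof. by rewrite -(scale0r 0) innerZr scale0r. Qed.

Lemma innerBr x y1 y2 : inner x (y1 - y2) = inner x y1 - inner x y2.
Proof. by rewrite innerDr -scaleN1r innerZr scaleN1r. Qed.

Lemma inner_ractl x a y : inner (ract x a) y = cmul (star a) (inner x y).
Proof. by rewrite innerC inner_ractr starM -innerC. Qed.

Lemma inner_inj y1 y2 : (forall x, inner x y1 = inner x y2) -> y1 = y2.
Proof.
move=> h; apply/eqP; rewrite -subr_eq0; apply/eqP/(inner_eq0 (s := X)).
by rewrite innerBr h subrr.
Qed.

Lemma star_norm (a : A) : `|star a| = `|a|.
Proof.
have le (b : A) : `|b| <= `|star b|.
  have [->|b0] := eqVneq b 0; first by rewrite normr0.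
  rewrite -(ler_pM2r (x := `|b|)) ?normr_gt0// -expr2 -cstar_norm.
  exact: cmul_norm_le.
by apply/eqP; rewrite eq_le le -{2}(starK a) le.
Qed.

Lemma inner_norm_leD x y : `|inner x y| <= 2 * (`|x| + `|y|) ^+ 2.
Proof.
have le (u v : X) : `|inner u v + inner v u| <= 2 * (`|u| + `|v|) ^+ 2.
  have -> : inner u v + inner v u =
      inner (u + v) (u + v) - inner u u - inner v v.
    rewrite innerDr !innerDl [inner u u + _]addrC addrACA.
    by rewrite -[RHS]addrA -opprD addrK addrC.
  apply: le_trans (ler_normB _ _) _.
  apply: le_trans (lerD (ler_normB _ _) (lexx _)) _.
  rewrite -!inner_norm mulr_natl mulr2n -addrA lerD//.
    by rewrite lerXn2r ?nnegrE ?addr_ge0// ler_normD.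
  by rewrite sqrrD [_ + _ *+ 2]addrC -addrA lerDr mulrn_wge0// mulr_ge0.
have ni : `|('i : R[i])| = 1 by rewrite normc_def/= expr0n expr1n add0r sqrtr1.
have iN : 'i * 'i = -1 :> R[i].
  by rewrite -expr2 sqr_i.
have ->: inner x y = 2^-1 *: ((inner x y + inner y x)
     - ('i : R[i]) *: (inner x ('i *: y) + inner ('i *: y) x)).
  have ci : conjc ('i : R[i]) = - 'i.
    by apply/eqP; rewrite eq_complex/= oppr0 !eqxx.
  rewrite innerZr innerZl ci ['i *: (_ + _)]scalerDr ['i *: _]scalerA iN.
  rewrite ['i *: _]scalerA mulrN iN opprK scaleN1r scale1r.
  rewrite opprD opprK addrACA subrr addr0 -mulr2n.
  by rewrite -[inner x y *+ 2]scaler_nat scalerA mulVf ?scale1r//.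
rewrite normrZ gtr0_norm ?invr_gt0// ler_pdivrMl//.
apply: le_trans (ler_normB _ _) _.
rewrite normrZ ni mul1r [leRHS]mulr_natl mulr2n lerD//.
by apply: le_trans (le _ _) _; rewrite normrZ ni mul1r.
Qed.

(* The constant 8 is not optimal: polarization yields this bound without the
   order theory of the algebra. *)
Lemma inner_norm_leM x y : `|inner x y| <= 8 * (`|x| * `|y|).
Proof.
have [->|x0] := eqVneq x 0.
  by rewrite innerC inner0r star_norm !normr0 mul0r mulr0.
have [->|y0] := eqVneq y 0; first by rewrite inner0r !normr0 !mulr0.
have := inner_norm_leD (`|x|^-1 *: x) (`|y|^-1 *: y).
have nZ (u v : X) (z : R[i]) : `|inner (z *: u) v| = `|z| * `|inner u v|.
  by rewrite innerC innerZr star_norm normrZ innerC star_norm.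
rewrite innerZr normrZ nZ !normrZ !normfV !normr_id !mulVf ?normr_eq0//.
rewrite [`|y|^-1 * _]mulrA -invfM ler_pdivrMl ?mulr_gt0 ?normr_gt0//.
move=> /le_trans; apply; rewrite [`|y| * _]mulrC [leRHS]mulrC.
by rewrite ler_wpM2l ?mulr_ge0// -[1 + 1]/(2%:R) -natrX -natrM.
Qed.

End InnerTheory.

Section Adjointable.
Variables (R : realType) (A : cstarAlgType R) (X : hilbertModType A).

Definition is_adjoint (f g : X -> X) : Prop :=
  forall x y, inner (f x) y = inner x (g y).

Record is_adjointable (f : X -> X) : Prop := IsAdjointable {
  adjointable_linear : linear f;
  adjointable_ract : forall x a, f (ract x a) = ract (f x) a;
  adjointable_bounded : exists M : R, forall x, `|f x| <= M%:C * `|x|;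
  adjointable_adj : exists g, is_adjoint f g
}.

Record adjointable := Adjointable {
  adjointable_fun :> X -> X;
  adjointableP : is_adjointable adjointable_fun
}.

HB.instance Definition _ (T : adjointable) :=
  GRing.isLinear.Build R[i] X X *:%R T (adjointable_linear (adjointableP T)).

Lemma adjointable_ext (S T : adjointable) : S =1 T -> S = T.
Proof.
case: S T => [f fP] [g gP] /= /funext fg.
by move: fP gP; rewrite fg => fP gP; congr Adjointable; exact: Prop_irrelevance.
Qed.

Lemma is_adjoint_sym f g : is_adjoint f g -> is_adjoint g f.
Proof. by move=> fg x y; rewrite innerC -fg -innerC. Qed.

Lemma is_adjoint_uniq f g h : is_adjoint f g -> is_adjoint f h -> g =1 h.
Proof. by move=> fg fh y; apply: inner_inj => x; rewrite -fg fh. Qed.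

Lemma adjoint_adjointable f g :
  is_adjointable f -> is_adjoint f g -> is_adjointable g.
Proof.
move=> [_ _ [M fM] _] fg; split.
- move=> z x y; apply: inner_inj => u.
  by rewrite -fg !innerDr !innerZr !fg.
- by move=> x a; apply: inner_inj => u; rewrite -fg !inner_ractr fg.
- exists (8 * M) => y; have [->|gy0] := eqVneq (g y) 0.
    have [->|y0] := eqVneq y 0; first by rewrite !normr0 mulr0.
    rewrite normr0 mulr_ge0// rmorphM/= mulr_ge0 ?ler0c//.
    have := le_trans (normr_ge0 _) (fM y).
    by rewrite pmulr_lge0 ?normr_gt0// ler0c.
  rewrite -(ler_pM2l (x := `|g y|)) ?normr_gt0// -expr2 inner_norm -fg.
  apply: le_trans (inner_norm_leM _ _) _.
  rewrite rmorphM/= !mulrA [_ * 8%:C]mulrC -!mulrA rmorph_nat ler_pM2l//.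
  by rewrite !mulrA ler_wpM2r// [_ * M%:C]mulrC.
- by exists f; exact: is_adjoint_sym.
Qed.

Definition adj (T : adjointable) : adjointable :=
  let g := cid (adjointable_adj (adjointableP T)) in
  Adjointable (adjoint_adjointable (adjointableP T) (projT2 g)).

Lemma adjP (T : adjointable) : is_adjoint T (adj T).
Proof. exact: projT2 (cid _). Qed.

Lemma op_zero_subproof : is_adjointable (fun=> 0).
Proof.
split.
- by move=> z x y; rewrite scaler0 addr0.
- by move=> x a; rewrite -[in RHS](scale0r 0) ractZl scale0r.
- by exists 0 => x; rewrite normr0 mul0r.
- exists (fun=> 0) => x y; rewrite inner0r innerC inner0r.
  by apply/eqP; rewrite -normr_eq0 star_norm normr0.
Qed.

Definition op_zero : adjointable := Adjointable op_zero_subproof.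

Lemma op_comp_subproof (S T : adjointable) : is_adjointable (S \o T).
Proof.
split => /=.
- by move=> z x y; rewrite !linearP.
- by move=> x a; rewrite !(adjointable_ract (adjointableP _)).
- have [M SM] := adjointable_bounded (adjointableP S).
  have [N TN] := adjointable_bounded (adjointableP T).
  exists (`|M| * `|N|) => x; rewrite rmorphM/= -mulrA.
  apply: le_trans (SM _) _; apply: le_trans (_ : `|M|%:C * `|T x| <= _).
    by rewrite ler_wpM2r// lecR ler_norm.
  rewrite ler_wpM2l ?ler0c//; apply: le_trans (TN x) _.
  by rewrite ler_wpM2r// lecR ler_norm.
- by exists (adj T \o adj S) => x y /=; rewrite !adjP.
Qed.

Definition op_comp (S T : adjointable) : adjointable :=
  Adjointable (op_comp_subproof S T).

Definition is_mp_inverse (T S : adjointable) : Prop :=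
  [/\ op_comp (op_comp T S) T = T, op_comp (op_comp S T) S = S,
      adj (op_comp T S) = op_comp T S & adj (op_comp S T) = op_comp S T].

Lemma op_compA (S T U : adjointable) :
  op_comp S (op_comp T U) = op_comp (op_comp S T) U.
Proof. exact: adjointable_ext. Qed.

Lemma adj_comp (S T : adjointable) :
  adj (op_comp S T) = op_comp (adj T) (adj S).
Proof.
apply/adjointable_ext/(is_adjoint_uniq (adjP (op_comp S T))) => x y /=.
by rewrite !adjP.
Qed.

Lemma adjK : involutive adj.
Proof.
move=> T; apply/adjointable_ext/(is_adjoint_uniq (adjP (adj T))).
exact/is_adjoint_sym/adjP.
Qed.

Lemma mp_inverse_uniq (T S1 S2 : adjointable) :
  is_mp_inverse T S1 -> is_mp_inverse T S2 -> S1 = S2.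
Proof.
move=> [h1 k1 l1 r1] [h2 k2 l2 r2].
have eqTS : op_comp T S1 = op_comp T S2.
  by rewrite -l1 -[in LHS]h2 -op_compA adj_comp l1 l2 op_compA h1.
have eqST : op_comp S1 T = op_comp S2 T.
  by rewrite -r1 -[in LHS]h2 -op_compA op_compA adj_comp r1 r2 -op_compA
    [op_comp T (op_comp S1 T)]op_compA h1.
by rewrite -k1 eqST -op_compA eqTS op_compA.
Qed.

(* The value is [op_zero] when there is no Moore-Penrose inverse. *)
Definition mp_inverse (T : adjointable) : adjointable :=
  if pselect (exists S, is_mp_inverse T S) is left h then projT1 (cid h)
  else op_zero.

Lemma mp_inverseP (T S : adjointable) :
  is_mp_inverse T S -> mp_inverse T = S.
Proof.
rewrite /mp_inverse; case: pselect => [h|+ TS]; last by case; exists S.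
exact: mp_inverse_uniq (projT2 (cid h)).
Qed.

Definition EP (T : adjointable) : Prop :=
  closure (range T) = closure (range (adj T)).

Definition is_isomorphism (V : adjointable) : Prop := bijective V.

End Adjointable.

Arguments adjointable {R A} X.

(* Main.v *)
Require Import Defs.
From HB Require Import structures.
From mathcomp Require Import all_boot all_order all_algebra.
From mathcomp Require Import all_classical all_reals all_analysis.
From mathcomp Require Import complex ring lra.

(** The three conditions say the same thing about kernels once the
Moore-Penrose inverse [S] of [T] is available: each of them forces [T] and its
adjoint to have the same kernel (and the same range), which is equivalent to
[T S = S T].  Indeed [1 - S T] and [1 - T S] are the orthogonal projections
onto the kernels of [T] and of its adjoint.  Writing [P] for the common
projection [T S = S T], the isomorphisms asked for are corner operators
[B + (1 - P)], where [B] is invertible in the corner algebra cut out by [P]: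
[B = T^* S] works for the adjoint and [B = S S] for the Moore-Penrose inverse.
These algebraic facts are [mp_commute], [corner_isomorphism], [mp_range].

The analytic content is that a closed range gives a Moore-Penrose inverse
([mp_inverse_exists]).  In a Hilbert module a closed submodule need not be
complemented, so the orthogonal projection onto [E = range T] has to be
constructed from [T].

The adjoint of [T] is bounded below on [E] ([adj_bounded_below]).  The elements
[y] of [E] with [|T^* y| <= 1] are weakly bounded on [E], because
[<y, T z> = <T^* y, z>]; a gliding hump in the complete space [E] makes them
bounded in norm ([weakly_bounded_bounded]).

Then [H = T T^*] is selfadjoint and bounded below on [E], and it maps [E] onto
itself ([selfadjoint_onto]).  This is the method of continuity along [H + i t]:
for real [t] the vectors [H x + i t x] and [H x - i t x] have the same norm,
since the cross terms of their inner squares cancel, hence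
[|t| |x| <= |H x + i t x|].  Together with the lower bound of [H] this bounds
all the operators [H + i t] below by one constant, so surjectivity, which holds
for large [t], propagates down to [t = 0] in steps of fixed length.

Finally every [y] has some [w] in [E] with [T^* T T^* w = T^* y].  The map
[G : y |-> w] is its own adjoint, which makes it linear and module-linear for
free, and [T^* G] is the Moore-Penrose inverse. *)

Set Implicit Arguments.
Unset Strict Implicit.
Unset Printing Implicit Defensive.

Import Order.TTheory GRing.Theory Num.Theory.
Import numFieldNormedType.Exports.

Local Open Scope classical_set_scope.
Local Open Scope complex_scope.
Local Open Scope ring_scope.

(** * Norms as real numbers *)

Section RealNorm.
Variables (R : realType) (V : normedModType R[i]).
Implicit Types x y : V.

(** The norms of a normed module over [R[i]] are elements of [R[i]], whose order
is partial; their real parts live in an ordered field. *)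
Definition rnorm x : R := complex.Re `|x|.

Lemma rnormE x : `|x| = (rnorm x)%:C.
Proof. by rewrite /rnorm RRe_real ?normr_real. Qed.

Lemma rnorm_ge0 x : 0 <= rnorm x.
Proof. by rewrite -ler0c -rnormE. Qed.

Lemma rnorm0 : rnorm (0 : V) = 0.
Proof. by apply: complexI; rewrite -rnormE normr0. Qed.

Lemma rnorm_eq0 x : rnorm x = 0 -> x = 0.
Proof. by move=> x0; apply/eqP; rewrite -normr_eq0 rnormE x0. Qed.

Lemma rnormD x y : rnorm (x + y) <= rnorm x + rnorm y.
Proof. by rewrite -lecR rmorphD/= -!rnormE ler_normD. Qed.

Lemma rnormN x : rnorm (- x) = rnorm x.
Proof. by rewrite /rnorm normrN. Qed.

Lemma rnormB x y : rnorm (x - y) <= rnorm x + rnorm y.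
Proof. by rewrite -(rnormN y) rnormD. Qed.

Lemma rdistC x y : rnorm (x - y) = rnorm (y - x).
Proof. by rewrite /rnorm distrC. Qed.

Lemma rdistD y x z : rnorm (x - z) <= rnorm (x - y) + rnorm (y - z).
Proof. by rewrite -[x in leLHS](subrK y) -addrA rnormD. Qed.

Lemma rnormZ (z : R[i]) x : rnorm (z *: x) = Normc.normc z * rnorm x.
Proof. by apply: complexI; rewrite rmorphM/= -!rnormE normrZ. Qed.

Lemma ball_rnorm x (e : R) y : ball x e%:C y <-> rnorm (x - y) < e.
Proof. by rewrite -ltcR -rnormE -ball_normE. Qed.

Lemma rnorm_closure (E : set V) x (e : R) :
  closure E x -> 0 < e -> exists2 y, E y & rnorm (x - y) < e.
Proof.
move=> Ex e0; have e0' : 0 < e%:C by rewrite ltcR.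
have [y [Ey /ball_rnorm xy]] := Ex _ (nbhsx_ballx x e%:C e0').
by exists y.
Qed.

End RealNorm.

Lemma normcR (R : realType) (t : R) : Normc.normc t%:C = `|t|.
Proof. by rewrite /= expr0n addr0 sqrtr_sqr. Qed.

Lemma normcRi (R : realType) (t : R) : Normc.normc (0 +i* t) = `|t|.
Proof. by rewrite /= expr0n add0r sqrtr_sqr. Qed.

(** * Sequences and perturbations in a closed set *)

Lemma expr_small (R : realType) (C r e : R) :
  0 <= r < 1 -> 0 < e -> exists n, C * r ^+ n < e.
Proof.
move=> /andP[r0 r1] e0.
have : (fun n => C * r ^+ n) @ \oo --> C * 0.
  by apply: cvgMr; apply: cvg_expr; rewrite ger0_norm.
rewrite mulr0 => /cvgrPdist_lt /(_ e e0)[n _ /(_ n (leqnn n))/=].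
rewrite sub0r normrN => h; exists n; exact: le_lt_trans (ler_norm _) h.
Qed.

Section Complete.
Variables (R : realType) (V : completeNormedModType R[i]).
Variables (E : set V) (E_closed : closed E).

Lemma geometric_limit (u : nat -> V) (C r : R) : 0 <= r < 1 ->
    (forall n, E (u n)) -> (forall n, rnorm (u n.+1 - u n) <= C * r ^+ n) ->
  exists2 x, E x & forall n, rnorm (x - u n) <= C / (1 - r) * r ^+ n.
Proof.
move=> r01 Eu du; have /andP[r0 r1] := r01.
have C0 : 0 <= C by have := le_trans (rnorm_ge0 _) (du 0%N); rewrite mulr1.
set D := C / (1 - r).
have D0 : 0 <= D by rewrite divr_ge0// subr_ge0 ltW.
(* Telescoping: the subtracted term is what makes the induction on [k] work. *)
have dist n k : rnorm (u (n + k)%N - u n) <= D * (r ^+ n - r ^+ (n + k)%N).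
  elim: k => [|k IH]; first by rewrite addn0 !subrr rnorm0 mulr0.
  apply: le_trans (rdistD (u (n + k)%N) _ _) _.
  apply: le_trans (lerD _ IH) _; first by rewrite addnS; exact: du.
  rewrite le_eqVlt; apply/orP; left; apply/eqP.
  by rewrite addnS exprS /D; field; rewrite gt_eqF// subr_gt0.
have distle n m : (n <= m)%N -> rnorm (u m - u n) <= D * r ^+ n.
  move=> /subnKC <-; apply: le_trans (dist _ _) _.
  by rewrite ler_wpM2l// gerBl exprn_ge0.
have : cauchy (u @ \oo).
  apply/cauchyP => e e0.
  have eE : (complex.Re e)%:C = e by rewrite RRe_real// gtr0_real.
  have [n nP] : exists n, D * r ^+ n < complex.Re e.
    by apply: expr_small => //; rewrite -ltcR eE.
  exists (u n); exists n => // m /= nm; rewrite -eE; apply/ball_rnorm.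
  by rewrite rdistC; exact: le_lt_trans (distle _ _ nm) nP.
move=> /cauchy_cvg/cvg_ex[x /= ux].
exists x => [|n].
  by apply: closed_cvg ux => //; exact: nearW.
apply/ler_addgt0Pr => e e0.
have e0' : 0 < e%:C by rewrite ltcR.
have [N _ /(_ (maxn n N) (leq_maxr _ _))/= /ball_rnorm xu] :=
  ux _ (nbhsx_ballx x e%:C e0').
apply: le_trans (rdistD (u (maxn n N)) _ _) _.
rewrite [leRHS]addrC; apply: lerD; first exact: ltW.
by apply: distle; exact: leq_maxl.
Qed.

Lemma contraction_fixpoint (f : V -> V) (q : R) : 0 <= q < 1 -> E !=set0 ->
    (forall x, E x -> E (f x)) ->
    (forall x y, E x -> E y -> rnorm (f x - f y) <= q * rnorm (x - y)) ->
  exists2 x, E x & f x = x.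
Proof.
move=> q01 [x0 Ex0] Ef fq; have /andP[q0 q1] := q01.
pose u n := iter n f x0.
have Eu n : E (u n) by elim: n => //= n; exact: Ef.
have [|x Ex xu] := @geometric_limit u (rnorm (u 1%N - u 0%N)) q q01 Eu.
  elim=> [|n IH]; first by rewrite mulr1.
  apply: (le_trans (fq _ _ (Eu n.+1) (Eu n))).
  by rewrite exprS mulrCA ler_wpM2l.
exists x => //; apply/eqP; rewrite -subr_eq0; apply/eqP/rnorm_eq0/eqP.
rewrite eq_le rnorm_ge0 andbT; apply/ler_addgt0Pr => e e0.
set D := _ / _ in xu.
have [n nP] := expr_small (D * 2) q01 e0.
rewrite add0r (le_trans (rdistD (u n.+1) _ _))//.
have h1 := le_trans (fq _ _ Ex (Eu n)) (ler_wpM2l q0 (xu n)).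
have := xu n.+1; rewrite (rdistC x) exprS => h2.
apply: (le_trans (lerD h1 h2)); apply: ltW; apply: le_lt_trans nP.
have : 0 <= D * q ^+ n by exact: le_trans (rnorm_ge0 _) (xu n).
by nra.
Qed.

(** If [N] maps onto [E] and [g] is a right inverse, the solutions of
[N x + K x = y] are the fixed points of [x |-> g (y - K x)], and this map is
[k / m]-Lipschitz. *)
Lemma perturbation_onto (N K : V -> V) (k m : R) : 0 <= k < m ->
    {in E &, forall x y, E (x - y)} ->
    (forall x, E x -> E (K x)) ->
    (forall y, E y -> exists2 x, E x & N x = y) ->
    {in E &, forall x y, m * rnorm (x - y) <= rnorm (N x - N y)} ->
    {in E &, forall x y, rnorm (K x - K y) <= k * rnorm (x - y)} ->
  forall y, E y -> exists2 x, E x & N x + K x = y.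
Proof.
move=> /andP[k0 km] EB EK N_onto Nm Kk y Ey.
have m0 : 0 < m by exact: le_lt_trans km.
have /choice[g gP] z : exists x, E z -> E x /\ N x = z.
  have [/N_onto[x Ex Nx]|nE] := pselect (E z); first by exists x.
  by exists 0.
have Eg x : E x -> E (y - K x).
  by move=> Ex; apply: EB; rewrite inE//; exact: EK.
have [||x Ex|x1 x2 Ex1 Ex2|x Ex xP] :=
    @contraction_fixpoint (fun x => g (y - K x)) (k / m).
- by rewrite divr_ge0 ?(ltW m0)//= ltr_pdivrMr// mul1r.
- by exists y.
- exact: (gP _ (Eg _ Ex)).1.
- have [Eg1 Ng1] := gP _ (Eg _ Ex1); have [Eg2 Ng2] := gP _ (Eg _ Ex2).
  have := Nm _ _ (mem_set Eg1) (mem_set Eg2); rewrite Ng1 Ng2.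
  rewrite opprB [_ + (K x2 - y)]addrC addrA subrK => h.
  rewrite mulrAC ler_pdivlMr// mulrC; apply: le_trans h _.
  by rewrite rdistC; apply: Kk; exact: mem_set.
- exists x => //; rewrite -[in N x]xP (gP _ (Eg _ Ex)).2.
  by rewrite subrK.
Qed.

End Complete.

(** * Weakly bounded sets in a Hilbert module *)

Definition closed_subspace (R : realType) (V : normedModType R[i])
    (E : set V) : Prop :=
  [/\ closed E, E 0 & forall z x y, E x -> E y -> E (z *: x + y)].

Section ClosedSubspace.
Variables (R : realType) (V : normedModType R[i]) (E : set V).
Variables (E_sub : closed_subspace E).

Lemma closed_subspaceD x y : E x -> E y -> E (x + y).
Proof. by case: E_sub => _ _ h; rewrite -{2}(scale1r x); exact: h. Qed.

Lemma closed_subspaceZ z x : E x -> E (z *: x).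
Proof. by case: E_sub => _ E0 h Ex; rewrite -(addr0 (z *: x)); exact: h. Qed.

Lemma closed_subspaceB x y : E x -> E y -> E (x - y).
Proof.
move=> Ex Ey; apply: closed_subspaceD => //.
by rewrite -scaleN1r; exact: closed_subspaceZ.
Qed.

End ClosedSubspace.

Section Inner.
Variables (R : realType) (A : cstarAlgType R) (X : hilbertModType A).
Implicit Types x y : X.

Lemma rnorm_inner x : rnorm (inner x x) = rnorm x ^+ 2.
Proof. by apply: complexI; rewrite rmorphXn/= -!rnormE inner_norm. Qed.

Lemma rnorm_inner_le x y : rnorm (inner x y) <= 8 * (rnorm x * rnorm y).
Proof.
rewrite -lecR -rnormE !rmorphM/= -!rnormE rmorph_nat.
exact: inner_norm_leM.
Qed.

Lemma innerBl x1 x2 y : inner (x1 - x2) y = inner x1 y - inner x2 y.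
Proof. by rewrite -scaleN1r innerDl innerZl rmorphN rmorph1 scaleN1r. Qed.

(** A uniform boundedness principle for the functionals [inner y] on [E], proved
by a gliding hump: if [y n] grows fast enough, steps of length [r ^+ n] in the
direction of [y n] lead to some [x] in [E] at which the values
[inner (y n) x] are unbounded. *)
Lemma weakly_bounded_bounded (E Y : set X) : closed_subspace E -> Y `<=` E ->
    (forall x, E x -> exists M, forall y, Y y -> rnorm (inner y x) <= M) ->
  exists M, forall y, Y y -> rnorm y <= M.
Proof.
move=> E_sub YE wb; apply: contrapT => /forallNP unb.
(* All steps after the [n]-th one change [inner (y n) x] by at most
   [8 * |y n| * (r / (1 - r)) * r ^+ n]; the 8 is the constant of
   [inner_norm_leM].  The ratio 1/64 makes this less than the gain
   [|y n| * r ^+ n / 2] of the [n]-th step. *)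
pose r : R := 64^-1.
have r0 : 0 < r by rewrite invr_gt0.
have /choice[y yP] n : exists y, Y y /\ n%:R / r ^+ n < rnorm y.
  apply: contrapT => /forallNP h; apply: (unb (n%:R / r ^+ n)) => y Yy.
  by rewrite leNgt; apply/negP => yn; apply: (h y).
pose e n := (rnorm (y n))^-1%:C *: y n.
pose step n x :=
  if rnorm (inner (y n) x) < r ^+ n * rnorm (y n) / 2
  then x + (r ^+ n)%:C *: e n else x.
pose fix u n := if n is m.+1 then step m (u m) else 0.
have y0 n : 0 < rnorm (y n).
  apply: le_lt_trans (yP n).2; by rewrite divr_ge0// exprn_ge0// ltW.
have rn0 n : 0 < r ^+ n by rewrite exprn_gt0.
have norme n : rnorm (e n) = 1.
  by rewrite rnormZ normcR ger0_norm ?invr_ge0 ?ltW// mulVf// gt_eqF.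
have step_le n x : rnorm (step n x - x) <= r ^+ n.
  rewrite /step; case: ifP => _; last by rewrite subrr rnorm0 ltW.
  by rewrite addrC addKr rnormZ normcR norme mulr1 gtr0_norm.
(* The values of [inner (y n)] at [x] and at [x + r ^+ n *: e n] differ by
   [r ^+ n * |y n|], so one of them is at least half of that. *)
have step_ge n x : r ^+ n * rnorm (y n) / 2 <= rnorm (inner (y n) (step n x)).
  rewrite /step; case: ltP => // lt.
  have := rnormB (inner (y n) (x + (r ^+ n)%:C *: e n)) (inner (y n) x).
  rewrite innerDr [X in rnorm (X - _)]addrC addrK !innerZr !rnormZ !normcR.
  rewrite rnorm_inner gtr0_norm// gtr0_norm ?invr_gt0// expr2 mulKf ?gt_eqF//.
  by lra.
have [E_closed E0 _] := E_sub.
have Eu n : E (u n).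
  elim: n => //= n IH; rewrite /step; case: ifP => // _.
  apply: closed_subspaceD => //; do 2 apply: closed_subspaceZ => //.
  exact: YE (yP n).1.
have [||x Ex xu] := @geometric_limit _ _ E E_closed u 1 r _ Eu.
- by rewrite /r; lra.
- by move=> n; rewrite mul1r; exact: step_le.
have [M MP] := wb x Ex.
have [n Mn] : exists n : nat, M * 4 < n%:R.
  exists (Num.truncn `|M * 4|).+1.
  by apply: le_lt_trans (ler_norm _) _; rewrite truncnS_gt.
have := MP _ (yP n).1; apply/negP; rewrite -ltNge.
have h1 := step_ge n (u n).
have h2 := le_trans (rnorm_inner_le (y n) (x - u n.+1))
  (ler_wpM2l (ler0n R 8) (ler_wpM2l (ltW (y0 n)) (xu n.+1))).
have h3 : rnorm (inner (y n) (u n.+1)) <=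
    rnorm (inner (y n) x) + rnorm (inner (y n) (x - u n.+1)).
  have := rnormB (inner (y n) x) (inner (y n) (x - u n.+1)).
  by rewrite -innerBr opprB addrC subrK.
have h4 : n%:R < r ^+ n * rnorm (y n).
  by have := (yP n).2; rewrite ltr_pdivrMr// mulrC.
move: h2; rewrite exprS.
set t := r ^+ n * rnorm (y n) in h1 h4 *.
have -> : 8 * (rnorm (y n) * (1 / (1 - r) * (r * r ^+ n))) = 8 / 63 * t.
  by rewrite /t /r; field.
move=> h2.
have : rnorm (inner (y n) (u n.+1)) = rnorm (inner (y n) (step n (u n))) by [].
have : 0 <= n%:R :> R by [].
by lra.
Qed.

End Inner.

(** * Surjectivity of selfadjoint operators that are bounded below *)

Section Selfadjoint.
Variables (R : realType) (A : cstarAlgType R) (X : hilbertModType A).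
Implicit Types (x y : X) (T : adjointable X) (f g : X -> X).

Lemma adjointable_rbounded T :
  exists2 M : R, 0 <= M & forall x, rnorm (T x) <= M * rnorm x.
Proof.
have [M TM] := adjointable_bounded (adjointableP T).
exists `|M| => // x; apply: le_trans (_ : M * rnorm x <= _).
  by rewrite -lecR rmorphM/= -!rnormE.
by rewrite ler_wpM2r ?rnorm_ge0// ler_norm.
Qed.

(** Linearity over the scalars and over the algebra comes from the
nondegeneracy of the inner product. *)
Lemma adjoint_bounded_adjointable f g (M : R) : is_adjoint f g ->
  (forall x, rnorm (f x) <= M * rnorm x) -> is_adjointable f.
Proof.
move=> fg fM; have gf := is_adjoint_sym fg; split.
- by move=> z x y; apply: inner_inj => u; rewrite -gf !innerDr !innerZr !gf.
- by move=> x a; apply: inner_inj => u; rewrite -gf !inner_ractr gf.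
- by exists M => x; rewrite !rnormE -rmorphM lecR.
- by exists g.
Qed.

(** The vectors [T x + i t x] and [T x - i t x] have the same inner square
[<T x, T x> + t ^+ 2 <x, x>], hence the same norm, and their difference is
[2 i t x]. *)
Lemma selfadjoint_shift_ge T (t : R) x : is_adjoint T T ->
  `|t| * rnorm x <= rnorm (T x + (0 +i* t) *: x).
Proof.
move=> TT; set z : R[i] := 0 +i* t.
have zJ : conjc z = - z by apply/eqP; rewrite eq_complex/= oppr0 !eqxx.
have exp w : conjc w = - w ->
    inner (T x + w *: x) (T x + w *: x)
    = inner (T x) (T x) - (w * w) *: inner x x.
  move=> wJ; rewrite innerDl !innerDr !innerZl !innerZr wJ (TT x x).
  by rewrite -scalerDr scaleNr scalerDr scalerA opprD addrA addrK.
have same : rnorm (T x - z *: x) = rnorm (T x + z *: x).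
  apply/eqP; rewrite -(@eqrXn2 _ 2) ?rnorm_ge0//; apply/eqP.
  rewrite -!rnorm_inner -scaleNr (exp _ zJ) exp ?mulrNN//.
  by apply/eqP; rewrite eq_complex/= !oppr0 !eqxx.
have := rnormB (T x + z *: x) (T x - z *: x).
rewrite same opprB [T x + _]addrC addrA [_ - T x]addrAC addrK.
rewrite -scalerDl rnormZ.
have -> : z + z = 0 +i* (2 * t).
  by apply/eqP; rewrite eq_complex/= addr0 eqxx/=; apply/eqP; ring.
by rewrite normcRi normrM ger0_norm//; lra.
Qed.

(** Method of continuity: [T + i t] maps [E] onto [E] for large [t], and the
bounds below by [t] and by [c - t] allow perturbations by less than [c / 2]
whatever [t >= 0] is, which brings [t] down to 0 in steps of length [c / 4]. *)
Lemma selfadjoint_onto T (E : set X) (c : R) : is_adjoint T T ->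
    closed_subspace E -> (forall x, E x -> E (T x)) -> 0 < c ->
    (forall x, E x -> c * rnorm x <= rnorm (T x)) ->
  forall y, E y -> exists2 x, E x & T x = y.
Proof.
move=> TT E_sub ET c0 Tc; have [E_closed _ _] := E_sub.
have EB : {in E &, forall x y, E (x - y)}.
  by move=> x y; rewrite !inE; exact: closed_subspaceB.
pose N t x := T x + (0 +i* t) *: x.
have NB t x y : N t x - N t y = N t (x - y).
  by rewrite /N scalerBr linearB/= opprD addrACA.
have [M M0 TM] := adjointable_rbounded T.
pose d := c / 4.
have d0 : 0 < d by rewrite divr_gt0.
pose onto t := forall y, E y -> exists2 x, E x & N t x = y.
have onto_large n : M < n%:R * d -> onto (n%:R * d).
  move=> nM y Ey; pose t := n%:R * d.
  have t0 : 0 < t by exact: le_lt_trans nM.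
  have zt_onto z : E z -> exists2 x, E x & (0 +i* t) *: x = z.
    exists ((0 +i* t)^-1 *: z); first exact: closed_subspaceZ.
    rewrite scalerA mulfV ?scale1r// eq_complex/= negb_and (gt_eqF t0).
    by rewrite orbT.
  have [|x1 x2 _ _|x1 x2 _ _|x Ex xP] := @perturbation_onto _ _ E E_closed
      (fun x => (0 +i* t) *: x) T M t _ EB ET zt_onto _ _ y Ey.
  - by rewrite M0.
  - by rewrite -scalerBr rnormZ normcRi gtr0_norm.
  - by rewrite -linearB/=; exact: TM.
  - by exists x; rewrite // /N addrC.
have onto_pred n : onto (n.+1%:R * d) -> onto (n%:R * d).
  move=> on y Ey.
  have EK x : E x -> E ((0 +i* (- d)) *: x) by exact: closed_subspaceZ.
  have [|x1 x2 Ex1 Ex2|x1 x2 _ _|x Ex xP] := @perturbation_onto _ _ E E_closed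
      (N (n.+1%:R * d)) _ d (2 * d) _ EB EK on _ _ y Ey.
  - by rewrite (ltW d0)/=; lra.
  - rewrite NB; set x := x1 - x2; set t := n.+1%:R * d.
    have Ex : E x by exact: EB.
    have h1 := selfadjoint_shift_ge t x TT.
    have h2 := rnormB (N t x) ((0 +i* t) *: x).
    have t0 : 0 < t by rewrite mulr_gt0.
    rewrite [X in rnorm X <= _]addrK rnormZ normcRi gtr0_norm// in h2.
    rewrite gtr0_norm// -/(N t x) in h1.
    have h3 := Tc _ Ex; have x0 := rnorm_ge0 x.
    have -> : 2 * d = c / 2 by rewrite /d; field.
    have [tc|/ltW ct] := lerP t (c / 2).
      by have := ler_wpM2r x0 tc; lra.
    by have := ler_wpM2r x0 ct; lra.
  - by rewrite -scalerBr rnormZ normcRi normrN gtr0_norm.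
  - exists x => //; rewrite -xP /N -addrA -scalerDl; congr (_ + _ *: _).
    by apply/eqP; rewrite eq_complex/= addr0 eqxx/= -natr1; apply/eqP; ring.
have onto0 n : onto (n%:R * d) -> onto 0.
  by elim: n => [|n IH /onto_pred]; rewrite ?mul0r.
have [n nM] : exists n : nat, M < n%:R * d.
  exists (Num.truncn (M / d)).+1; rewrite -ltr_pdivrMr//.
  by rewrite truncnS_gt.
move=> y /(onto0 _ (onto_large _ nM))[x Ex xy]; exists x => //.
by rewrite -xy /N complexr0 scale0r addr0.
Qed.

End Selfadjoint.

(** * Closed range and the Moore-Penrose inverse *)

Section MoorePenrose.
Variables (R : realType) (A : cstarAlgType R) (X : hilbertModType A).
Implicit Types (x y : X) (S T : adjointable X).

Lemma adj_adjoint T : is_adjoint (adj T) T.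
Proof. exact/is_adjoint_sym/adjP. Qed.

Lemma op_compE S T x : op_comp S T x = S (T x).
Proof. by []. Qed.

Lemma selfadjoint_adj T : is_adjoint T T -> adj T = T.
Proof. by move=> TT; exact/adjointable_ext/(is_adjoint_uniq (adjP T)). Qed.

Lemma range_closed_subspace T : closed (range T) -> closed_subspace (range T).
Proof.
move=> cT; split=> // [|z _ _ [x _ <-] [y _ <-]].
  by exists 0 => //; rewrite linear0.
by exists (z *: x + y) => //; rewrite linearP.
Qed.

(** The [y] in the range with [|T^* y| <= 1] are weakly bounded there because
[<y, T z> = <T^* y, z>]; homogeneity turns a norm bound for them into the
inequality. *)
Lemma adj_bounded_below T : closed (range T) ->
  exists2 c : R, 0 < c & forall y, range T y -> c * rnorm y <= rnorm (adj T y).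
Proof.
move=> cT; have E_sub := range_closed_subspace cT.
pose Y := [set y | range T y /\ rnorm (adj T y) <= 1].
have [|x [z _ <-]|M YM] := @weakly_bounded_bounded _ _ _ (range T) Y E_sub.
- by move=> y [].
- exists (8 * rnorm z) => y [_ y1]; rewrite -adj_adjoint.
  apply: le_trans (rnorm_inner_le _ _) _; rewrite ler_pM2l//.
  by rewrite -[leRHS]mul1r ler_wpM2r// rnorm_ge0.
have N0 : 0 < `|M| + 1 by rewrite ltr_wpDl.
exists (`|M| + 1)^-1; first by rewrite invr_gt0.
move=> y Ty; rewrite ler_pdivrMl//; set a := rnorm (adj T y).
have a0 : 0 <= a by exact: rnorm_ge0.
apply/ler_addgt0Pr => e e0.
(* Dividing by [a] itself would fail when [a = 0]. *)
pose s := a + e / (`|M| + 1).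
have s0 : 0 < s by rewrite ltr_wpDl// divr_gt0.
have Ys : Y (s^-1%:C *: y).
  split; first exact: closed_subspaceZ.
  rewrite linearZ/= rnormZ normcR gtr0_norm ?invr_gt0//.
  by rewrite ler_pdivrMl// mulr1 /s lerDl divr_ge0// ltW.
have := YM _ Ys; rewrite rnormZ normcR gtr0_norm ?invr_gt0//.
rewrite ler_pdivrMl// => ys.
have -> : (`|M| + 1) * a + e = s * (`|M| + 1).
  by rewrite /s; field; rewrite gt_eqF.
apply: le_trans ys _; rewrite ler_wpM2l ?(ltW s0)//.
by have := ler_norm M; lra.
Qed.

(** With [H = T T^*] invertible on the range [E] of [T], let [G y] be an element
of [E] with [T^* H (G y) = T^* y].  Then [T T^* G] is selfadjoint and fixes
[E]: it is the orthogonal projection onto [E], and the Penrose equations for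
[T^* G] are read off from it. *)
Lemma mp_inverse_exists T : closed (range T) -> exists S, is_mp_inverse T S.
Proof.
move=> cT; have E_sub := range_closed_subspace cT.
have [c c0 Tc] := adj_bounded_below cT.
pose H := op_comp T (adj T).
have HH : is_adjoint H H by move=> x y /=; rewrite adjP adj_adjoint.
have Hc y : range T y -> c ^+ 2 / 8 * rnorm y <= rnorm (H y).
  move=> Ey; have [->|y0] := eqVneq y 0.
    by rewrite rnorm0 mulr0 rnorm_ge0.
  have {}y0 : 0 < rnorm y.
    by rewrite lt0r rnorm_ge0 andbT; apply: contra_neq y0; exact: rnorm_eq0.
  rewrite mulrAC ler_pdivrMr// -(ler_pM2l y0) mulrCA -expr2 -exprMn.
  apply: le_trans (_ : rnorm (adj T y) ^+ 2 <= _).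
    by rewrite ler_sqr ?nnegrE ?mulr_ge0 ?rnorm_ge0 ?(ltW c0)// Tc.
  by rewrite -rnorm_inner adj_adjoint [_ * 8]mulrC [leRHS]mulrCA rnorm_inner_le.
have Honto : forall y, range T y -> exists2 x, range T x & H x = y.
  apply: selfadjoint_onto HH E_sub _ _ Hc; last by rewrite divr_gt0// exprn_gt0.
  by move=> x _; exists (adj T x).
(* Solving [H e = H y] in [E] gives the projection [e] of [y]: the vector
   [T^* (e - y)] has inner square [<e - y, H (e - y)> = 0].  Solving [H w = e]
   then gives the value of [G] at [y]. *)
have /choice[g gP] y : exists w, range T w /\ adj T (H w) = adj T y.
  have [|e Ee He] := Honto (H y); first by exists (adj T y).
  have [w Ew Hw] := Honto _ Ee.
  exists w; split => //; apply/eqP; rewrite -subr_eq0 -linearB Hw/=.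
  apply/eqP/(inner_eq0 (s := X)).
  by rewrite adj_adjoint -[T _]/(H _) linearB/= -[T _]/(H e) He subrr inner0r.
have gE y : range T (g y) := (gP y).1.
have gK y : adj T (H (g y)) = adj T y := (gP y).2.
have gg : is_adjoint g g.
  have half x y : inner (g x) y = inner (g x) (H (g y)).
    by have [u _ <-] := gE x; rewrite !adjP gK.
  by move=> x y; rewrite half -HH innerC -half -innerC.
(* [H (g y)] is the projection [q] of [y]: [<q, q> = <q, y>]. *)
have gb y : c ^+ 2 / 8 * rnorm (g y) <= 8 * rnorm y.
  apply: le_trans (Hc _ (gE y)) _; set q := H (g y).
  have [->|q0] := eqVneq q 0; first by rewrite rnorm0 mulr_ge0// rnorm_ge0.
  have {}q0 : 0 < rnorm q.
    by rewrite lt0r rnorm_ge0 andbT; apply: contra_neq q0; exact: rnorm_eq0.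
  rewrite -(ler_pM2l q0) -expr2 -rnorm_inner mulrCA.
  by rewrite {1}/q /= adjP gK -adjP rnorm_inner_le.
have [G Gg] : exists G : adjointable X, forall x, G x = g x.
  have c8 : 0 < c ^+ 2 / 8 by rewrite divr_gt0// exprn_gt0.
  have gM x : rnorm (g x) <= (c ^+ 2 / 8)^-1 * 8 * rnorm x.
    by rewrite -mulrA ler_pdivlMl.
  by exists (Adjointable (adjoint_bounded_adjointable gg gM)).
have GG : is_adjoint G G by move=> x y; rewrite !Gg.
have GK y : adj T (T (adj T (G y))) = adj T y by rewrite Gg gK.
(* This is the adjoint of [GK]. *)
have GTK y : G (T (adj T (T y))) = T y.
  apply: inner_inj => x; rewrite -GG -adj_adjoint -adjP -adj_adjoint.
  by rewrite GK adj_adjoint.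
(* The projection [Q = T T^* G] is selfadjoint: by [GTK] its adjoint
   [Q^* = G T T^*] fixes the range of [T], so [Q = Q^* Q], and by [GK] that
   is [Q^*]. *)
have QQ y : T (adj T (G y)) = G (T (adj T y)).
  by rewrite -[LHS]GTK GK.
exists (op_comp (adj T) G); split.
- by apply: adjointable_ext => x; rewrite !op_compE QQ GTK.
- by apply: adjointable_ext => x; rewrite !op_compE -QQ GK.
- apply: selfadjoint_adj => x y; rewrite !op_compE.
  by rewrite QQ GG adjP adj_adjoint.
- apply: selfadjoint_adj => x y; rewrite !op_compE.
  by rewrite adj_adjoint GG adjP.
Qed.

End MoorePenrose.

(** * Consequences of the Moore-Penrose equations *)

Section Equivalence.
Variables (R : realType) (A : cstarAlgType R) (X : hilbertModType A).
Implicit Types (x y : X) (S T B C P : adjointable X).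

Lemma corner_subproof B P : is_adjointable (fun x => B x + (x - P x)).
Proof.
have [M M0 BM] := adjointable_rbounded B.
have [N N0 PN] := adjointable_rbounded P.
apply: (@adjoint_bounded_adjointable _ _ _ _
  (fun x => adj B x + (x - adj P x)) (M + (1 + N))).
  by move=> x y; rewrite innerDl innerDr innerBl innerBr !adjP.
move=> x; apply: le_trans (rnormD _ _) _; rewrite mulrDl lerD//.
by apply: le_trans (rnormB _ _) _; rewrite mulrDl mul1r lerD.
Qed.

(** When [P] is a projection and [P B = B P = B], this is the operator that is
[B] on the range of [P] and the identity on its complement. *)
Definition corner B P : adjointable X := Adjointable (corner_subproof B P).

Lemma cornerE B P x : corner B P x = B x + (x - P x).
Proof. by []. Qed.

Lemma corner_isomorphism B C P :
    op_comp P B = B -> op_comp B P = B -> op_comp P C = C -> op_comp C P = C ->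
    op_comp B C = P -> op_comp C B = P ->
  is_isomorphism (corner B P).
Proof.
have E S T U : op_comp S T = U -> forall x, S (T x) = U x by move=> <-.
move=> /E PB /E BP /E PC /E CP /E BC /E CB.
have PP x : P (P x) = P x by rewrite -[P x]BC PB.
have cancelc (B' C' : adjointable X) :
    (forall x, P (B' x) = B' x) -> (forall x, C' (P x) = C' x) ->
    (forall x, C' (B' x) = P x) ->
  cancel (corner B' P) (corner C' P).
  move=> PB' CP' CB' x; rewrite !cornerE !linearD !linearN/= CB' PB' CP' PP.
  by rewrite !subrr !addr0 [B' x + _]addrC addrK addrC subrK.
by exists (corner C P); apply: cancelc.
Qed.

(** [T] kills [1 - S T], so the adjoint of [T] does as well; taking adjoints,
[S T T = T].  Exchanging the roles gives [T T S = T], and [S T T S] is then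
equal to both products. *)
Lemma mp_commute S T : is_mp_inverse T S ->
  (forall x, T x = 0 <-> adj T x = 0) -> op_comp T S = op_comp S T.
Proof.
move=> [TST STS TSa STa] ker.
have tst x : T (S (T x)) = T x by rewrite -[in RHS]TST.
have TSs : is_adjoint (T \o S) (T \o S).
  by move=> x y /=; rewrite -!op_compE adjP TSa.
have STs : is_adjoint (S \o T) (S \o T).
  by move=> x y /=; rewrite -!op_compE adjP STa.
have STT x : S (T (T x)) = T x.
  apply: inner_inj => y; rewrite -[RHS]adj_adjoint -STs/= -adj_adjoint.
  congr inner.
  apply/eqP; rewrite -subr_eq0 -linearB; apply/eqP/ker.
  by rewrite linearB/= tst subrr.
have TTS x : T (T (S x)) = T x.
  apply/eqP; rewrite -subr_eq0 -linearB; apply/eqP/ker.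
  apply: inner_inj => y; rewrite inner0r linearB innerBr -!adjP.
  by rewrite -[T (S x)]/((T \o S) x) -TSs/= tst subrr.
by apply: adjointable_ext => x; rewrite !op_compE -[in LHS]STT TTS.
Qed.

(** The kernel of the adjoint is the orthogonal complement of the range, and
orthogonality passes to the closure. *)
Lemma closure_range_ker S T : range S `<=` closure (range T) ->
  forall x, adj T x = 0 -> adj S x = 0.
Proof.
move=> ST x Tx0; apply: inner_inj => y; rewrite inner0r -adjP.
apply/rnorm_eq0/eqP; rewrite eq_le rnorm_ge0 andbT.
apply/ler_addgt0Pr => e e0; rewrite add0r.
pose b := 8 * rnorm x + 1.
have b0 : 0 < b by rewrite ltr_wpDl// mulr_ge0// rnorm_ge0.
have [|_ [u _ <-] yu] := @rnorm_closure _ _ _ (S y) (e / b)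
  (ST _ (ex_intro2 _ _ y I erefl)); first by rewrite divr_gt0.
have -> : inner (S y) x = inner (S y - T u) x.
  by rewrite innerBl (adjP T u) Tx0 inner0r subr0.
apply: le_trans (rnorm_inner_le _ _) _.
rewrite mulrCA (le_trans (ler_wpM2r _ (ltW yu)))//.
  by rewrite mulr_ge0// rnorm_ge0.
by rewrite mulrAC ler_pdivrMr// ler_wpM2l ?(ltW e0)// /b lerDl.
Qed.

(** [S = (S T)^* S = T^* S^* S] and [T^* = (S T) T^*]. *)
Lemma mp_range S T : is_mp_inverse T S -> range S = range (adj T).
Proof.
move=> [TST STS _ STa]; rewrite eqEsubset; split=> _ [x _ <-].
  exists (adj S (S x)) => //.
  by rewrite -op_compE -adj_comp STa !op_compE -[in RHS]STS.
exists (T (adj T x)) => //.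
by rewrite -!op_compE -STa -adj_comp op_compA TST.
Qed.

End Equivalence.

Theorem proposition2p2 (R : realType) (A : cstarAlgType R)
    (X : hilbertModType A) (T : adjointable X) (T_closed : closed (range T)) :
  [<-> (* (i) *) EP T /\ closed (range T);
       (* (ii) *) exists V : adjointable X,
         is_isomorphism V /\ adj T = op_comp V T;
       (* (iii) *) exists V : adjointable X,
         [/\ is_isomorphism V, mp_inverse T = op_comp V T &
             mp_inverse T = op_comp T V]].
Proof.
have [S TS_mp] := mp_inverse_exists T_closed.
have [TST STS TSa STa] := TS_mp.
have adjTST : op_comp (adj T) (op_comp T S) = adj T.
  by rewrite -TSa -adj_comp TST.
rewrite (mp_inverseP TS_mp); tfae.
- move=> [T_EP _].
  have comm : op_comp T S = op_comp S T.
    apply: mp_commute => // x; split=> [Tx0|].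
      move: Tx0; rewrite -{1}[T]adjK; apply: closure_range_ker.
      by rewrite -T_EP; exact: subset_closure.
    rewrite -{2}[T]adjK; apply: closure_range_ker.
    by rewrite T_EP; exact: subset_closure.
  pose P := op_comp T S.
  have TP : op_comp T P = T by rewrite /P comm op_compA.
  have Pa : adj P = P := TSa.
  have T'P : op_comp (adj T) P = adj T := adjTST.
  have PT' : op_comp P (adj T) = adj T by rewrite -{1}Pa -adj_comp TP.
  have SP : op_comp S P = S by rewrite op_compA STS.
  have PS : op_comp P S = S by rewrite /P comm STS.
  have PS' : op_comp P (adj S) = adj S by rewrite -{1}Pa -adj_comp SP.
  (* In the corner of [P], the inverse of [T^* S] is [T S^*]. *)
  exists (corner (op_comp (adj T) S) P); split.
    apply: (@corner_isomorphism _ _ _ _ (op_comp T (adj S))).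
    + by rewrite op_compA PT'.
    + by rewrite -op_compA SP.
    + by rewrite op_compA TST.
    + by rewrite -op_compA -{1}Pa -adj_comp PS.
    + rewrite -op_compA [op_comp S _]op_compA -comm PS'.
      by rewrite -adj_comp STa.
    + rewrite -op_compA [op_comp (adj S) _]op_compA -adj_comp TSa -/P.
      by rewrite PS.
  apply: adjointable_ext => x; rewrite op_compE cornerE.
  have -> : op_comp (adj T) S (T x) = op_comp (adj T) (op_comp S T) x by [].
  by rewrite -comm T'P -[P _]/(op_comp P T x) TST subrr addr0.
- move=> [V [[W VK WK] T'E]].
  have comm : op_comp T S = op_comp S T.
    apply: mp_commute => // x; rewrite T'E op_compE; split=> [->|Vx0].
      exact: linear0.
    by rewrite -[LHS]VK Vx0 -[in LHS](linear0 V) VK.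
  pose P := op_comp T S.
  have TP : op_comp T P = T by rewrite /P comm op_compA.
  have SP : op_comp S P = S by rewrite op_compA STS.
  have PS : op_comp P S = S by rewrite /P comm STS.
  (* In the corner of [P], the inverse of [S S] is [T T]. *)
  exists (corner (op_comp S S) P); split.
  + apply: (@corner_isomorphism _ _ _ _ (op_comp T T)).
    * by rewrite op_compA PS.
    * by rewrite -op_compA SP.
    * by rewrite op_compA TST.
    * by rewrite -op_compA TP.
    * by rewrite -op_compA [op_comp S (op_comp T T)]op_compA -comm TST -comm.
    * by rewrite -op_compA [op_comp T (op_comp S S)]op_compA PS.
  + apply: adjointable_ext => x; rewrite op_compE cornerE.
    rewrite -[P _]/(op_comp P T x) TST subrr addr0.
    by rewrite op_compE -[S (T x)]/(op_comp S T x) -comm -op_compE SP.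
  + apply: adjointable_ext => x; rewrite op_compE cornerE.
    rewrite linearD linearB/= -[T (P x)]/(op_comp T P x) TP subrr addr0.
    by rewrite -[in LHS]PS.
- move=> [V [[W VK WK] _ S_TV]]; split => //; rewrite /EP; congr closure.
  rewrite -(mp_range TS_mp) eqEsubset; split=> _ [x _ <-].
    by exists (W x) => //; rewrite S_TV op_compE WK.
  by exists (V x) => //; rewrite S_TV.
Qed.
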